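(* Let $q\ge4$ be a prime power and let $t$ and $r\ge3$ be positive integers with $2q^{r-3}<t\le q^{r-2}+q-1$. Let $\mathcal{C}$ be a projective $[q^{r-1}+q^{r-2}+t,\,r+1]_q$ linear code whose nonzero Hamming weights all lie in $\{q^{r-1},\ q^{r-1}+t-2q^{r-3},\ q^{r-1}+q^{r-2}+t\}$. Then $q$ is even, $t=q^{r-2}$, and $\mathcal{C}$ is a hypercylinder code.
   Context: A linear $[N,k]_q$ code is a $k$-dimensional $\mathbb{F}_q$-subspace of $\mathbb{F}_q^N$ with the Hamming weight. It is projective if in a generator matrix $G$ (a $k\times N$ matrix whose rows form a basis) no column is zero and no two columns are proportional. To such a code one associates the point set $\{\langle g_1\rangle,\ldots,\langle g_N\rangle\}\subseteq\mathrm{PG}(k-1,q)$ formed by the columns of $G$ (defined up to projective equivalence); conversely, a code associated with a spanning set of $N$ points of $\mathrm{PG}(k-1,q)$ is the row space of a matrix whose columns are representatives of these points. A hyperoval of $\mathrm{PG}(2,q)$ is a set of $q+2$ points no three collinear; a hypercylinder in $\mathrm{PG}(r,q)$ is $\left(\bigcup_{P\in\mathcal{H}}\langle P,\pi\rangle\right)\setminus\pi$, where $\pi$ is an $(r-3)$-dimensional subspace and $\mathcal{H}$ is a hyperoval in a plane disjoint from $\pi$. A hypercylinder code is a code associated with a hypercylinder in $\mathrm{PG}(r,q)$; it is a $[q^{r-1}+2q^{r-2},r+1,q^{r-1}]_q$ code. *)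

(* Defs.v *)
From HB Require Import structures.
From mathcomp Require Import all_boot all_order all_algebra.
From mathcomp Require Import finmap.

Set Implicit Arguments.
Unset Strict Implicit.
Unset Printing Implicit Defensive.

Import GRing.Theory.

(* The points of PG(V) are the 1-dimensional subspaces of V; a projective
   subspace of projective dimension d is a {vspace V} of dimension d + 1.
   Sets of points are finite sets of subspaces. *)
Section ProjectiveGeometry.
Variables (F : finFieldType) (V : vectType F).
Implicit Types (P Q R X L E pi : {vspace V}) (H S : {fset {vspace V}}).

Definition is_point X : bool := \dim X == 1%N.

Definition collinear P Q R : Prop :=
  exists L, [/\ \dim L = 2%N, (P <= L)%VS, (Q <= L)%VS & (R <= L)%VS].

Definition hyperoval_in E H : Prop :=
  [/\ {in H, forall P, is_point P && (P <= E)%VS},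
      #|` H| = (#|F| + 2)%N &
      {in H & &, forall P Q R,
        P != Q -> P != R -> Q != R -> ~ collinear P Q R}].

(* In PG(V) = PG(r, q), i.e. \dim V = r + 1, the vertex pi has projective
   dimension r - 3, hence vector space dimension r - 2. *)
Definition hypercylinder S : Prop :=
  exists pi E H,
    [/\ (\dim pi + 3)%N = \dim {:V}, \dim E = 3%N, (E :&: pi)%VS = 0%VS,
        hyperoval_in E H &
        forall X, X \in S <->
          [/\ is_point X, ~~ (X <= pi)%VS &
              exists2 P, P \in H & (X <= P + pi)%VS]].

End ProjectiveGeometry.

Section Codes.
Variables (F : finFieldType) (N : nat).
Implicit Types (C : {vspace 'rV[F]_N}).

Definition hamming_weight (v : 'rV[F]_N) : nat := #|[set j | v ord0 j != 0%R]|.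

Definition generator_matrix C k (G : 'M[F]_(k, N)) : Prop :=
  basis_of C [tuple row i G | i < k].

Definition proportional k (u v : 'cV[F]_k) : Prop :=
  exists a : F, u = (a *: v)%R.

Definition projective_code C : Prop :=
  exists G : 'M[F]_(\dim C, N),
    [/\ generator_matrix C G, forall j, col j G != 0%R &
        forall i j, i != j -> ~ proportional (col i G) (col j G)].

(* The columns of G are representatives of the points of S, one for each
   point. That the rows of G are independent amounts to S spanning
   PG(k-1, q). *)
Definition associated_code k (S : {fset {vspace 'cV[F]_k}}) C : Prop :=
  exists G : 'M[F]_(k, N),
    [/\ generator_matrix C G, forall j, col j G != 0%R,
        injective (fun j => <[col j G]>%VS) &
        forall X, X \in S <-> exists j, X = <[col j G]>%VS].

Definition hypercylinder_code r C : Prop :=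
  exists S : {fset {vspace 'cV[F]_(r.+1)}},
    hypercylinder S /\ associated_code S C.

End Codes.

(* Main.v *)
(** For a generator matrix with columns g_j and x in F^(r+1), let z(x) be the
    number of columns annihilated by x, i.e. the size of a hyperplane section.
    With Q = q^(r-3), every x != 0 has z(x) in {0, m, M}, where m = Qq + 2Q and
    M = Qq + t, and the first two moments of z are known because no two columns
    are proportional.

    t = Qq: for r = 3 this is divisibility in the standard equations.  For
    r >= 4 the second moment gives |t - Qq| < q; if q did not divide t, then
    counting along pencils would show that every nonempty codimension 2 section
    has at least 2Q points, which is too many for the average codimension 2
    section inside a hyperplane with m points.

    Structure: the functionals with z(x) <> m, together with 0, number q^3.
    Counting along pencils shows that this set is stable under adding multiples
    of an x with z(x) = 0, hence it contains the span of two such x and a third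
    vector, a 3-space A; this also forces q even.  The common kernel of A is the
    vertex: projecting from it, every line of the plane carries 0 or M columns,
    so each nonempty fibre has Qq columns, hence is full, and the image is a
    set of q + 2 points met by every line in 0 or 2 points. *)
Require Import Defs.
From HB Require Import structures.
From mathcomp Require Import all_boot all_order all_algebra.
From mathcomp Require Import mxabelem finfield zify.
From mathcomp Require Import finmap.

Set Implicit Arguments.
Unset Strict Implicit.
Unset Printing Implicit Defensive.
Import GRing.Theory.

(** * Annihilators of one and of two columns *)

Section Annihilators.
Local Open Scope ring_scope.
Variable F : finFieldType.

Lemma scale_vec_inj (V : lmodType F) (x : V) :
  x != 0 -> injective (fun a : F => a *: x).
Proof.
move=> x0 a b /eqP; rewrite -subr_eq0 -scalerBl scaler_eq0 (negPf x0) orbF.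
by rewrite subr_eq0 => /eqP.
Qed.

Lemma card_left_ker k l (A : 'M[F]_(k, l)) :
  #|[set x : 'rV_k | x *m A == 0]| = (#|F| ^ (k - \rank A))%N.
Proof.
rewrite -mxrank_ker -card_rowg; apply: eq_card => x.
by rewrite !inE; apply/eqP/sub_kermxP.
Qed.

Lemma card_left_ker1 k (v : 'cV[F]_k.+1) : v != 0 ->
  #|[set x : 'rV_k.+1 | x *m v == 0]| = (#|F| ^ k)%N.
Proof.
move=> v0; rewrite card_left_ker -mxrank_tr rank_rV.
by rewrite -(inj_eq trmx_inj) trmxK trmx0 v0 subn1.
Qed.

Lemma card_left_ker2 k (u v : 'cV[F]_k.+2) : v != 0 -> ~ proportional u v ->
  #|[set x : 'rV_k.+2 | (x *m u == 0) && (x *m v == 0)]| = (#|F| ^ k)%N.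
Proof.
move=> v0 nuv.
have -> : [set x : 'rV_k.+2 | (x *m u == 0) && (x *m v == 0)] =
  [set x : 'rV_k.+2 | x *m row_mx u v == 0].
  by apply/setP => x; rewrite !inE mul_mx_row row_mx_eq0.
rewrite card_left_ker -mxrank_tr.
suff /eqP -> : row_free (row_mx u v)^T by rewrite subn2.
apply: inj_row_free => w; rewrite tr_row_mx -[w]hsubmxK mul_row_col.
move: (lsubmx w) (rsubmx w) => a b.
rewrite [a]mx11_scalar [b]mx11_scalar !mul_scalar_mx -!linearZ -raddfD /=.
move=> /eqP; rewrite trmx_eq0 => /eqP.
have [->|a0 /eqP] := eqVneq (a 0 0) 0.
  rewrite scale0r add0r => /eqP.
  by rewrite scaler_eq0 (negPf v0) orbF => /eqP ->; rewrite raddf0 row_mx0.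
rewrite addr_eq0 => /eqP e; case: nuv; exists (- ((a 0 0)^-1 * b 0 0)).
by rewrite scaleNr -scalerA -scalerN -e scalerA mulVf ?scale1r.
Qed.

End Annihilators.

(** * Section sizes and pencils of functionals *)

Section ZeroCounts.
Local Open Scope ring_scope.
Variables (F : finFieldType) (J : finType) (k : nat) (g : J -> 'cV[F]_k).
Local Notation q := #|F|.

Definition zeros (x : 'rV[F]_k) : nat := #|[set j | x *m g j == 0]|.
Definition common_zeros (x y : 'rV[F]_k) : nat :=
  #|[set j | (x *m g j == 0) && (y *m g j == 0)]|.

Lemma zeros0 : zeros 0 = #|J|.
Proof. by apply: eq_card => j; rewrite !inE mul0mx eqxx. Qed.

Lemma card_as_sum (T : finType) (P : pred T) :
  #|[set x | P x]| = (\sum_x P x)%N.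
Proof. by rewrite -sum1dep_card big_mkcond; apply: eq_bigr => x _; case: (P x). Qed.

Lemma zerosE x : zeros x = (\sum_j (x *m g j == 0%R))%N.
Proof. exact: card_as_sum. Qed.

Lemma sum_zeros (X : {pred 'rV[F]_k}) :
  (\sum_(x in X) zeros x = \sum_j #|[set x in X | x *m g j == 0%R]|)%N.
Proof.
under eq_bigr do rewrite zerosE.
rewrite exchange_big /=; apply: eq_bigr => j _.
by rewrite card_as_sum big_mkcond; apply: eq_bigr => x _; case: (x \in X).
Qed.

Lemma mul_row_col_eq0 (x : 'rV[F]_k) (v : 'cV[F]_k) :
  (x *m v == 0) = ((x *m v) 0 0 == 0).
Proof.
apply/eqP/eqP => [->|e]; first by rewrite mxE.
by apply/matrixP => i j; rewrite !ord1 e mxE.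
Qed.

(** A column annihilated by both [x] and [y] is counted by all q + 1 members of the pencil; every
    other column is counted by exactly one of them. *)
Lemma pencil x y :
  (\sum_(b : F) zeros (x + b *: y)%R + zeros y = #|J| + q * common_zeros x y)%N.
Proof.
rewrite /common_zeros card_as_sum zerosE.
under [X in (X + _)%N]eq_bigr do rewrite zerosE.
rewrite exchange_big /= -sum1_card big_distrr /= -!big_split /=.
apply: eq_bigr => j _.
rewrite !mul_row_col_eq0.
under eq_bigr => b _ do rewrite mul_row_col_eq0 mulmxDl -scalemxAl mxE [X in _ + X]mxE.
set a := (x *m g j) 0 0; set c := (y *m g j) 0 0.
have [->|c0] := eqVneq c 0.
  under eq_bigr => b _ do rewrite mulr0 addr0.
  rewrite sum_nat_const andbT.
  by rewrite addnC.
rewrite andbF muln0 !addn0 (bigD1 (- a / c)) //= big1 ?addn0.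
  by rewrite divfK // subrr eqxx.
move=> b bn; apply/eqP; rewrite eqb0; apply: contra bn => /eqP e.
apply/eqP; apply: (mulIf c0); rewrite divfK //.
by apply/eqP; rewrite -addr_eq0 addrC e.
Qed.

End ZeroCounts.

(** * Arithmetic of the moment and pencil equations *)

Lemma finField_card_odd_or_div4 (F : finFieldType) :
  4 <= #|F| -> odd #|F| || (4 %| #|F|).
Proof.
have [p p_pr pF] := finPcharP F; have := card_pprimeChar pF.
have /= -> : #|pPrimeCharType pF| = #|F| by [].
move: (logn p _) => n -> q4; have [/eqP p2|op] := prime.even_prime p_pr; last first.
  by rewrite oddX op orbT.
move: q4; rewrite (eqP p2); case: n => [|[|n]] // _.
by rewrite !expnS mulnA dvdn_mulr ?orbT.
Qed.

(** Case r = 3. The level sizes are [b1 * p] and [b2 * p] with [p] = q - 1, and [u] is the gap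
    between the two positive section sizes. Eliminating one unknown from the two moments leaves a
    factor [p * u] to cancel. *)
Lemma solid_counts q t p u n b1 b2 :
  q = p.+1 -> t = u + 2 -> n = q ^ 2 + q + t -> 0 < p -> 0 < u ->
  b1 * p * (q + 2) + b2 * p * (q + t) + n = n * q ^ 3 ->
  b1 * p * (q + 2) ^ 2 + b2 * p * (q + t) ^ 2 + n ^ 2 + n * q ^ 2 =
    n * q ^ 3 + n ^ 2 * q ^ 2 ->
  b1 * (q + 2) = n * q ^ 2 /\ b2 * (q + t) = n * (q + 1).
Proof.
move=> -> -> -> p0 u0 E1 E2.
have up : 0 < p * u by rewrite muln_gt0 p0 u0.
split; apply/eqP; rewrite -(eqn_pmul2l up); apply/eqP.
  have := congr1 (fun z => (p.+1 + (u + 2)) * z) E1; clear E1; move: E2.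
  rewrite !expnS !expn0 => *; lia.
have := congr1 (fun z => (p.+1 + 2) * z) E1; clear E1; move: E2.
rewrite !expnS !expn0 => *; lia.
Qed.

Lemma solid_arith q t b1 b2 n :
  4 <= q -> odd q || (4 %| q) -> 2 < t -> t <= 2 * q - 1 -> n = q ^ 2 + q + t ->
  b1 * (q + 2) = n * q ^ 2 -> b2 * (q + t) = n * (q + 1) -> t = q.
Proof.
move=> q4 qp t2 tq -> e1 e2.
(* Modulo [q + 2], q is -2, so n * q^2 becomes 4 * (t + 2). *)
have d1 : q + 2 %| 4 * (t + 2).
  have h : q + 2 %| (q ^ 2 + q + t) * q ^ 2 by rewrite -e1 dvdn_mull.
  rewrite -(dvdn_addl _ (dvdn_mulr (q ^ 3 + 2 * q + t * q) (dvdnn (q + 2)))).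
  have -> : 4 * (t + 2) + (q + 2) * (q ^ 3 + 2 * q + t * q) =
    (q ^ 2 + q + t) * q ^ 2 + (q + 2) * (q ^ 2 + 4 + 2 * t).
    by rewrite !expnS !expn0; lia.
  by rewrite dvdn_addl // dvdn_mulr.
(* Modulo [q + t], n is q^2; if q is invertible then [q + t] divides q + 1, which is absurd as t >
   2. *)
have d2 : coprime (q + t) q -> t = q.
  move=> co; have h : q + t %| (q ^ 2 + q + t) * (q + 1) by rewrite -e2 dvdn_mull.
  have : q + t %| q ^ 2 * (q + 1).
    rewrite -(dvdn_addl _ (dvdn_mulr (q + 1) (dvdnn (q + t)))).
    by rewrite -mulnDl addnA.
  rewrite Gauss_dvdr ?coprimeXr // => /dvdn_leq; lia.
case/orP: qp => [qo|/dvdnP[h qh]].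
  have /dvdnP[c ec] : q + 2 %| t + 2.
    rewrite -(Gauss_dvdr (n := 4)) // (_ : 4 = 2 ^ 2) // coprimeXr //.
    by rewrite coprimen2 oddD qo.
  (* Since t + 2 <= 2 * q + 1, the quotient [c] can only be 1. *)
  by case: c ec => [|[|c]] ec; lia.
have co2 : coprime (2 * h + 1) 2 by rewrite coprimen2 oddD oddM.
have /dvdnP[c ec] : 2 * h + 1 %| t + 2.
  rewrite -(Gauss_dvdr (n := 2)) // -(@dvdn_pmul2l 2) // mulnA.
  by move: d1; rewrite qh; congr (_ %| _); lia.
have {}d2 : coprime (q + t) 2 -> coprime (q + t) h -> t = q.
  move=> c1 c2; apply: d2; rewrite {2}qh coprimeMr c2 /=.
  by rewrite (_ : 4 = 2 ^ 2) // coprimeXr.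
(* Here 0 < c < 4. The quotient 2 means t = q, while 1 and 3 make [q + t] equal to 6h - 1 and 10h +
   1, both coprime to 2 and to h, so that [d2] applies. *)
case: c ec => [|[|[|[|c]]]] ec; try lia.
- apply: d2; first by rewrite coprimen2; lia.
  rewrite coprime_sym /coprime (_ : q + t = 5 * h + h.-1); last lia.
  rewrite gcdnMDl; have -> : h = h.-1.+1 by lia.
  by rewrite /= -/(coprime _ _) coprimeSn.
- apply: d2; first by rewrite coprimen2; lia.
  rewrite coprime_sym /coprime (_ : q + t = 10 * h + 1); last lia.
  by rewrite gcdnMDl gcdn1.
Qed.

(** Positive section sizes are at least [m], so, leaving out the zero functional, the second moment
    is at least [m] times the first; this fails once [q * m] reaches [n + q]. *)
Lemma moments_lower q Q m M n B1 B2 :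
  m <= M -> 0 < m -> m < n ->
  B1 * m + B2 * M + n = n * (Q * q ^ 3) ->
  B1 * m ^ 2 + B2 * M ^ 2 + n ^ 2 + n * (Q * q ^ 2) =
    n * (Q * q ^ 3) + n ^ 2 * (Q * q ^ 2) ->
  q * m < n + q.
Proof.
move=> mM m0 mn E1 E2; rewrite ltnNge; apply/negP => le.
have B2le : B2 * M * m <= B2 * M * M by rewrite leq_mul2l mM orbT.
have h1 : m * (n * (Q * q ^ 3)) + n ^ 2 + n * (Q * q ^ 2) <=
    n * (Q * q ^ 3) + n ^ 2 * (Q * q ^ 2) + m * n.
  by rewrite -E2 -E1 -!mulnn; move: B2le; clear; lia.
have h2 : n * (m * (Q * q ^ 3) + n + Q * q ^ 2) <= n * (Q * q ^ 3 + n * (Q * q ^ 2) + m).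
  by move: h1; clear; rewrite -!mulnn; lia.
rewrite leq_pmul2l in h2; last by lia.
have h3 : (n + q) * (Q * q ^ 2) <= q * m * (Q * q ^ 2) by rewrite leq_mul2r le orbT.
by move: h2 h3 mn; rewrite !expnS !expn0; clear; lia.
Qed.

(** If the smaller positive size did not occur, the two moments would give (q - 1) * t = Q * q + q -
    2, which is too small for t > 2 * Q. *)
Lemma moments_two_values q Q t n B2 :
  4 <= q -> 0 < Q -> 2 * Q < t -> n = Q * q ^ 2 + Q * q + t ->
  B2 * (Q * q + t) + n = n * (Q * q ^ 3) ->
  B2 * (Q * q + t) ^ 2 + n ^ 2 + n * (Q * q ^ 2) !=
    n * (Q * q ^ 3) + n ^ 2 * (Q * q ^ 2).
Proof.
move=> q4 Q0 Qt en E1; apply/eqP => E2.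
have n0 : 0 < n by lia.
have h1 : n * ((Q * q + t) * (Q * q ^ 3) + n + Q * q ^ 2) =
    n * (Q * q ^ 3 + n * (Q * q ^ 2) + (Q * q + t)).
  move: (congr1 (fun z => (Q * q + t) * z) E1) E2; clear; rewrite -!mulnn; lia.
move/eqP: h1; rewrite eqn_pmul2l // => /eqP h1.
have h2 : (Q * q * q) * (q * t + 2) = (Q * q * q) * (Q * q + t + q).
  move: h1; rewrite en; clear; rewrite !expnS !expn0; lia.
move/eqP: h2; rewrite eqn_pmul2l; last by rewrite !muln_gt0 Q0; lia.
move=> /eqP h2.
have h3 : 3 * t <= (q - 1) * t by rewrite leq_mul2r; lia.
have h4 : (q - 1) * (2 * Q + 1) <= (q - 1) * t by rewrite leq_mul2l; lia.
have h5 : 4 * Q <= q * Q by rewrite leq_mul2r q4 orbT.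
have h6 : (q - 1) * t + t = q * t by rewrite mulnBl mul1n subnK // leq_pmull //; lia.
have h7 : (q - 1) * (2 * Q + 1) + 2 * Q + 1 = q * (2 * Q + 1).
  by rewrite mulnBl mul1n -addnA subnK // leq_pmull //; lia.
by move: h2 h4 h5 h6 h7 q4; clear; lia.
Qed.

Lemma pencil_arith q Q t s c :
  2 * Q < t ->
  q * s + (Q * q ^ 2 + Q * q + t) =
    q.+1 * (Q * q + 2 * Q) + c * (Q * q + t - (Q * q + 2 * Q)) ->
  q * s + (t - 2 * Q) = 2 * Q * q + c * (t - 2 * Q).
Proof. by move=> tQ; rewrite subnDl -mulnn; move: (t - 2 * Q) (subnK (ltnW tQ)); lia. Qed.

(** [S1 + S2] is the sum of section sizes inside a hyperplane with m columns, over the functionals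
    vanishing at one of these columns: [S1] comes from the multiples of the hyperplane's own
    functional, [S2] from the others, at least 2 * Q each. Comparison with the exact total leaves (Q
    - 1) * q <= (Q - 1) * 2. *)
Lemma section_arith q Q S1 S2 :
  4 <= q -> 0 < Q ->
  q * (Q * q + 2 * Q) <= S1 -> (Q * q ^ 3 - q) * (2 * Q) <= S2 ->
  S1 + S2 + Q * q ^ 2 = Q * q ^ 3 + (Q * q + 2 * Q) * (Q * q ^ 2) -> Q <= 1.
Proof.
move=> q4 Q0 h1 h2 e; rewrite leqNgt; apply/negP => Q1.
have q3 : Q * q * (q ^ 2) = Q * q ^ 3 by rewrite !expnS !expn0; lia.
have le : q <= Q * q ^ 3.
  by rewrite -q3 mulnAC; apply: leq_pmull; rewrite muln_gt0 Q0 expn_gt0; lia.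
have h3 : 2 * Q * (Q * q ^ 3) <= S2 + 2 * Q * q.
  by move: h2; rewrite mulnBl leq_subLR; lia.
have h4 : Q * (q * q + q * q + 2 * Q * q ^ 3) <=
          Q * (q ^ 3 + Q * q ^ 3 + 2 * Q * q ^ 2).
  by move: h1 h3 e; rewrite !expnS !expn0; clear; lia.
rewrite leq_pmul2l // in h4.
have h5 : q * q * ((Q - 1) * q) <= q * q * ((Q - 1) * 2).
  have [k Qk] : exists k, Q = k.+1 by exists Q.-1; lia.
  by move: h4; rewrite Qk subn1 /= !expnS !expn0; clear; lia.
rewrite leq_pmul2l in h5; last by rewrite muln_gt0; lia.
by rewrite leq_pmul2l in h5; lia.
Qed.

(** * First and second moments of the section sizes *)

Section Moments.
Local Open Scope ring_scope.
Variables (F : finFieldType) (J : finType) (d : nat) (g : J -> 'cV[F]_d.+2).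
Local Notation q := #|F|.
Hypothesis g_neq0 : forall j, g j != 0.

(** A singleton for the columns of a projective code; for the columns projected from the vertex, a
    fibre of the projection. *)
Definition fibre (j0 : J) : {set J} := [set j | [exists a, g j == a *: g j0]].

(** Double counting: a column outside the fibre of [j0] imposes a second independent condition on
    [y], a column inside imposes none. Proportional columns are allowed, so that projected columns
    are covered. *)
Lemma sum_zeros_at j0 :
  (\sum_(y in [pred y : 'rV_d.+2 | y *m g j0 == 0%R]) zeros g y +
     #|fibre j0| * q ^ d = #|fibre j0| * q ^ d.+1 + #|J| * q ^ d)%N.
Proof.
have -> : (#|J| * q ^ d = #|fibre j0| * q ^ d + #|~: fibre j0| * q ^ d)%N.
  by rewrite -mulnDl cardsC.
rewrite addnA [RHS]addnAC; congr (_ + _)%N.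
rewrite sum_zeros (bigID (mem (fibre j0))) /= -!sum_nat_const.
congr (_ + _)%N.
  apply: eq_bigr => j; rewrite inE => /existsP[a /eqP e].
  rewrite -(card_left_ker1 (g_neq0 j0)); apply: eq_card => x; rewrite !inE.
  by case: eqP => //= x0; rewrite e -scalemxAr x0 scaler0 eqxx.
rewrite (eq_bigl (mem (~: fibre j0))) => [|j]; last by rewrite !inE.
apply: eq_bigr => j; rewrite !inE => nj.
rewrite -(card_left_ker2 (u := g j) (v := g j0)) //.
  by apply: eq_card => x; rewrite !inE andbC.
by move=> [a e]; case/negP: nj; apply/existsP; exists a; apply/eqP.
Qed.

Lemma sum_zeros_all : (\sum_x zeros g x = #|J| * q ^ d.+1)%N.
Proof.
rewrite (eq_bigl (mem predT)) // sum_zeros -sum_nat_const; apply: eq_bigr => j _.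
by rewrite -(card_left_ker1 (g_neq0 j)); apply: eq_card => x; rewrite !inE.
Qed.

Hypothesis g_inj : forall i j, i != j -> ~ proportional (g i) (g j).

Lemma fibre1 j : #|fibre j| = 1%N.
Proof.
rewrite -(cards1 j); apply: eq_card => i; rewrite !inE.
apply/existsP/eqP => [[a /eqP e]|->]; last by exists 1; rewrite scale1r.
by apply/eqP; apply: contraT => /g_inj; case; exists a.
Qed.

(** Writing one factor of the square as a sum over the columns annihilated by [x] and exchanging the
    sums reduces this to [sum_zeros_at] with singleton fibres. *)
Lemma sum_zeros_sq :
  (\sum_x zeros g x ^ 2 + #|J| * q ^ d = #|J| * q ^ d.+1 + #|J| ^ 2 * q ^ d)%N.
Proof.
have -> : (\sum_x zeros g x ^ 2 = \sum_j
    \sum_(y in [pred y : 'rV_d.+2 | y *m g j == 0%R]) zeros g y)%N.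
  rewrite (exchange_big_dep predT) //=; apply: eq_bigr => x _.
  by rewrite sum_nat_const -mulnn; congr (_ * _)%N; apply: eq_card => j; rewrite !inE.
set S := (\sum_j _)%N.
have -> : (S + #|J| * q ^ d = \sum_(j : J) (q ^ d.+1 + #|J| * q ^ d))%N.
  have e : (\sum_(j : J) q ^ d = #|J| * q ^ d)%N by rewrite sum_nat_const.
  rewrite -{1}e -big_split; apply: eq_bigr => j _ /=.
  by have := sum_zeros_at j; rewrite fibre1 !mul1n.
by rewrite sum_nat_const mulnDr mulnA -mulnn.
Qed.

End Moments.

(** * Level sets of the section size and their moment equations *)

Section ThreeValues.
Local Open Scope ring_scope.
Variables (F : finFieldType) (J : finType) (d : nat) (g : J -> 'cV[F]_d.+2).
Local Notation q := #|F|.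
Hypothesis g_neq0 : forall j, g j != 0.
Hypothesis g_inj : forall i j, i != j -> ~ proportional (g i) (g j).
Variables (m M : nat).
Hypothesis m_gt0 : (0 < m)%N.
Hypothesis m_ltM : (m < M)%N.
Hypothesis zerosP : forall x : 'rV[F]_d.+2, x != 0 -> zeros g x \in [:: 0; m; M]%N.

Definition level (i : nat) : {set 'rV[F]_d.+2} :=
  [set x | (x != 0) && (zeros g x == i)].

Lemma sum_levels (h : nat -> nat) :
  (\sum_x h (zeros g x) =
   h #|J| + #|level 0| * h 0 + #|level m| * h m + #|level M| * h M)%N.
Proof.
rewrite (bigD1 0) //= zeros0 -!addnA; congr (_ + _)%N.
rewrite -!sum_nat_const.
rewrite [X in (X + _)%N]big_mkcond [X in (_ + (X + _))%N]big_mkcond.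
rewrite [X in (_ + (_ + X))%N]big_mkcond [LHS]big_mkcond -!big_split.
apply: eq_bigr => x _; rewrite /= !inE.
have [//|x0] := eqVneq x 0; rewrite /=.
have := zerosP x0; rewrite !inE.
case/or3P => /eqP ->; rewrite ?eqxx.
- by rewrite !ltn_eqF ?addn0 // (ltn_trans m_gt0).
- by rewrite gtn_eqF // ltn_eqF // add0n addn0.
- by rewrite gtn_eqF 1?gtn_eqF // (ltn_trans m_gt0).
Qed.

Lemma level_count :
  (#|level 0| + #|level m| + #|level M| + 1 = q ^ d.+2)%N.
Proof.
have := sum_levels (fun _ => 1%N); rewrite sum1_card card_mx mul1n => ->.
by rewrite !muln1 addnC !addnA.
Qed.

Lemma level_count1 :
  (#|level m| * m + #|level M| * M + #|J| = #|J| * q ^ d.+1)%N.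
Proof.
have := sum_levels id; rewrite /= (sum_zeros_all g_neq0) => ->.
by rewrite muln0 addn0 [LHS]addnC addnA.
Qed.

Lemma level_count2 :
  (#|level m| * m ^ 2 + #|level M| * M ^ 2 + #|J| ^ 2 + #|J| * q ^ d =
   #|J| * q ^ d.+1 + #|J| ^ 2 * q ^ d)%N.
Proof.
have := sum_levels (fun n => n ^ 2)%N => /= e.
rewrite -(sum_zeros_sq g_neq0 g_inj) e exp0n // muln0 addn0.
by congr (_ + _)%N; rewrite addnC addnA.
Qed.

Lemma zerosZ a x : a != 0 -> zeros g (a *: x) = zeros g x.
Proof.
move=> a0; apply: eq_card => j; rewrite !inE -scalemxAl scaler_eq0.
by rewrite (negPf a0).
Qed.

(** The nonzero scalars act freely on a level, which splits into orbits of size q - 1. *)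
Lemma level_dvd i : (q.-1 %| #|level i|)%N.
Proof.
pose R (x y : 'rV[F]_d.+2) := [exists a, (a != 0) && (x == a *: y)].
have eqR : {in level i & &, equivalence_rel R}.
  move=> x y z _ _ _; split=> [|/existsP[a /andP[a0 /eqP ->]]].
    by apply/existsP; exists 1; rewrite oner_neq0 scale1r eqxx.
  apply/existsP/existsP => -[b /andP[b0 /eqP e]].
    exists (a^-1 * b); rewrite mulf_neq0 ?invr_eq0 //=.
    by rewrite -scalerA -e scalerA mulVf // scale1r.
  by exists (a * b); rewrite mulf_neq0 //= e scalerA.
have pR := equivalence_partitionP eqR.
rewrite (card_uniform_partition (n := q.-1) _ pR) ?dvdn_mull //.
move=> A /imsetP[x xl ->].
have x0 : x != 0 by move: xl; rewrite inE => /andP[].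
rewrite -(cardsC1 (0 : F)) -(card_imset (mem [set~ 0]) (scale_vec_inj x0)).
apply: eq_card => y; rewrite !inE.
apply/andP/imsetP => [[_ /existsP[a /andP[a0 /eqP e]]]|].
  exists a^-1; first by rewrite !inE invr_eq0.
  by rewrite e scalerA mulVf // scale1r.
move=> [a]; rewrite !inE => a0 ->; split.
  by move: xl; rewrite inE scaler_eq0 (negPf a0) zerosZ.
by apply/existsP; exists a^-1; rewrite invr_eq0 a0 scalerA mulVf // scale1r eqxx.
Qed.

End ThreeValues.

(** * Determination of t *)

Section Excess.
Local Open Scope ring_scope.
Variables (F : finFieldType) (J : finType) (e t : nat) (g : J -> 'cV[F]_e.+4).
Local Notation q := #|F|.
Local Notation Q := (#|F| ^ e)%N.
Local Notation m := (#|F| ^ e * #|F| + 2 * #|F| ^ e)%N.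
Local Notation M := (#|F| ^ e * #|F| + t)%N.
Hypothesis q_ge4 : (4 <= q)%N.
Hypothesis g_neq0 : forall j, g j != 0.
Hypothesis g_inj : forall i j, i != j -> ~ proportional (g i) (g j).
Hypothesis cardJ : (#|J| = Q * q ^ 2 + Q * q + t)%N.
Hypothesis t_gt : (2 * Q < t)%N.
Hypothesis t_le : (t <= Q * q + q - 1)%N.
Hypothesis zerosP : forall x : 'rV[F]_e.+4, x != 0 -> zeros g x \in [:: 0; m; M]%N.

Lemma Q_gt0 : (0 < Q)%N. Proof. by rewrite expn_gt0 (leq_trans _ q_ge4). Qed.
Lemma m_gt0 : (0 < m)%N. Proof. by rewrite addn_gt0 !muln_gt0 Q_gt0 orbT. Qed.
Lemma m_ltM : (m < M)%N. Proof. by rewrite ltn_add2l. Qed.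

Lemma level_counts :
  [/\ (#|level g 0| + #|level g m| + #|level g M| + 1 = Q * q ^ 4)%N,
      (#|level g m| * m + #|level g M| * M + #|J| = #|J| * (Q * q ^ 3))%N &
      (#|level g m| * m ^ 2 + #|level g M| * M ^ 2 + #|J| ^ 2 +
         #|J| * (Q * q ^ 2) = #|J| * (Q * q ^ 3) + #|J| ^ 2 * (Q * q ^ 2))%N].
Proof.
have -> : (Q * q ^ 4 = q ^ e.+4)%N by rewrite -expnD addn4.
have -> : (Q * q ^ 3 = q ^ e.+3)%N by rewrite -expnD addn3.
have -> : (Q * q ^ 2 = q ^ e.+2)%N by rewrite -expnD addn2.
split.
- exact: level_count m_gt0 m_ltM zerosP.
- exact: level_count1 m_gt0 m_ltM zerosP.
- exact: level_count2 m_gt0 m_ltM zerosP.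
Qed.

Lemma excess_lower_bound : (Q * q < t + q)%N.
Proof.
have [_ E1 E2] := level_counts.
have := moments_lower (ltnW m_ltM) m_gt0 _ E1 E2; rewrite cardJ.
have q2 : (4 * (Q * q) <= q * (Q * q))%N by rewrite leq_mul2r q_ge4 orbT.
have q3 : (4 * Q <= q * Q)%N by rewrite leq_mul2r q_ge4 orbT.
have lt : (m < Q * q ^ 2 + Q * q + t)%N by rewrite -mulnn; lia.
by move/(_ lt); rewrite -mulnn; clear; lia.
Qed.

Lemma level_m_gt0 : (0 < #|level g m|)%N.
Proof.
have [_ E1 E2] := level_counts.
rewrite lt0n; apply/eqP => B1; rewrite B1 !mul0n !add0n in E1 E2.
by move/eqP: E2; apply/negP; exact: (moments_two_values q_ge4 Q_gt0 t_gt cardJ E1).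
Qed.

(** A common zero keeps every member of the pencil away from section size 0, so each contributes [m]
    or [M]; [c] counts those with [M]. *)
Lemma pencil_eq (x y : 'rV[F]_e.+4) :
  x != 0 -> (forall a, y != a *: x) -> (0 < common_zeros g x y)%N ->
  exists c, (q * common_zeros g x y + #|J| = q.+1 * m + c * (M - m))%N.
Proof.
move=> x0 yx cz.
have zE v : v != 0 -> (0 < zeros g v)%N -> zeros g v = (m + (zeros g v == M) * (M - m))%N.
  move=> /zerosP; rewrite !inE => /or3P[] /eqP -> //; first by rewrite ltn_eqF ?m_ltM ?mul0n ?addn0.
  by rewrite eqxx mul1n subnKC // ltnW // m_ltM.
have [j] : exists j, j \in [set j | (x *m g j == 0) && (y *m g j == 0)].
  by apply/set0Pn; rewrite -card_gt0.
rewrite inE => /andP[/eqP xj /eqP yj].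
have z0 a b : (0 < zeros g (a *: x + b *: y)%R)%N.
  rewrite card_gt0; apply/set0Pn; exists j.
  by rewrite inE mulmxDl -!scalemxAl xj yj !scaler0 addr0.
have y0 : y != 0 by have := yx 0; rewrite scale0r.
have xy b : x + b *: y != 0.
  have [->|b0] := eqVneq b 0; first by rewrite scale0r addr0.
  apply: contra (yx (- b^-1)) => /eqP/(congr1 (fun v => b^-1 *: v)).
  rewrite scaler0 scalerDr scalerA mulVf // scale1r => /eqP.
  by rewrite addrC addr_eq0 scaleNr.
exists (\sum_(b : F) (zeros g (x + b *: y)%R == M) + (zeros g y == M))%N.
rewrite addnC -pencil [X in (_ + X = _)%N]zE //; last by have := z0 0 1; rewrite scale0r add0r scale1r.
under eq_bigr => b _.
  rewrite zE //; last by have := z0 1 b; rewrite scale1r.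
  over.
have Fm : (\sum_(b : F) m = q * m)%N by rewrite sum_nat_const.
rewrite big_split /= Fm -big_distrl /= addnACA [(q.+1 * _)%N]mulSnr.
congr (_ + _)%N; by rewrite -mulnDl.
Qed.

(** Having s < 2 * Q common zeros forces [c] = 0 in the pencil equation; then t = 2 * Q * q + 2 * Q
    - q * s, a multiple of q because q divides Q when e > 0. *)
Lemma common_zeros_ge (x y : 'rV[F]_e.+4) :
  (0 < e)%N -> ~~ (q %| t)%N ->
  x != 0 -> (forall a, y != a *: x) -> (0 < common_zeros g x y)%N ->
  (2 * Q <= common_zeros g x y)%N.
Proof.
move=> e0 qt x0 yx cz; have [c] := pencil_eq x0 yx cz.
rewrite leqNgt; move: (common_zeros g x y) => s ec; apply: contra qt => sQ.
have qQ : (q %| Q)%N by rewrite dvdn_exp.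
rewrite cardJ in ec; have := pencil_arith t_gt ec.
case: c {ec} => [|c] ec; last first.
  have : (q * s.+1 <= q * (2 * Q))%N by rewrite leq_mul.
  move: ec; rewrite [(c.+1 * _)%N]mulSn; move: (t - _)%N => u.
  by move: (c * u)%N Q q q_ge4; clear; lia.
have ec2 : (t + s * q = 2 * Q * q + 2 * Q)%N by move: ec; lia.
by rewrite -(dvdn_addl _ (dvdn_mull s (dvdnn q))) ec2 dvdn_add // dvdn_mull.
Qed.

Lemma card_dvd_excess : (0 < e)%N -> (q %| t)%N.
Proof.
move=> e0; apply/contraT => qt.
have := level_m_gt0; rewrite card_gt0 => /set0Pn[x]; rewrite inE => /andP[x0 /eqP zx].
(* Restricting to the [m] columns annihilated by [x] turns codimension 2 sections into hyperplane
   sections. *)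
pose J' : finType := {j : J | x *m g j == 0}; pose g' (j : J') := g (val j).
have czE y : common_zeros g x y = zeros g' y.
  rewrite /zeros /common_zeros -(card_imset _ val_inj); apply: eq_card => j.
  rewrite !inE; apply/andP/imsetP => [[xj yj]|[[j' xj]]].
    by exists (exist _ j xj); rewrite ?inE.
  by rewrite inE /g' /= => yj ->.
have cJ' : #|J'| = m.
  by rewrite card_sig -zx; apply: eq_card => j; rewrite !inE.
have [j0] : exists j0 : J', j0 \in J' by apply/card_gt0P; rewrite cJ' m_gt0.
move=> _.
have := sum_zeros_at (g := g') (fun j => g_neq0 (val j)) j0.
rewrite fibre1 => [|i j ij]; last by apply: g_inj; rewrite (inj_eq val_inj).
rewrite !mul1n cJ'.
under eq_bigr do rewrite -czE.
have x_j0 : x *m g' j0 = 0 by apply/eqP; exact: (valP j0).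
(* Multiples of [x] annihilate all [m] columns; any other [y] vanishing at [j0] gives a nonempty
   codimension 2 section, bounded by [common_zeros_ge]. *)
rewrite (bigID (mem [set a *: x | a : F])) /=.
set S1 := (X in (X + _ + _)%N); set S2 := (X in (_ + X + _)%N) => eS.
pose X := [set a *: x | a : F].
have cX : #|X| = q by rewrite (card_imset _ (scale_vec_inj x0)); exact: eq_card.
have S1E : (q * m <= S1)%N.
  have -> : (q * m = \sum_(y in X) m)%N by rewrite sum_nat_const cX.
  rewrite /S1 [leqRHS](eq_bigl (mem X)) => [|y].
    apply: leq_sum => y /imsetP[a _ ->].
    rewrite -{1}zx; apply: subset_leq_card; apply/subsetP => j; rewrite !inE.
    by move=> /eqP xj; rewrite -scalemxAl xj scaler0 eqxx.
  rewrite /= andb_idl // => /imsetP[a _ ->].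
  by rewrite -topredE /= -scalemxAl x_j0 scaler0 eqxx.
pose Y := [set y : 'rV[F]_e.+4 | y *m g' j0 == 0].
have XY : X \subset Y.
  by apply/subsetP => _ /imsetP[a _ ->]; rewrite inE -scalemxAl x_j0 scaler0 eqxx.
have cY : (#|Y| = Q * q ^ 3)%N.
  by rewrite (card_left_ker1 (g_neq0 (val j0))) -expnD addn3.
have S2E : ((Q * q ^ 3 - q) * (2 * Q) <= S2)%N.
  have -> : ((Q * q ^ 3 - q) * (2 * Q) = \sum_(y in Y :\: X) 2 * Q)%N.
    by rewrite sum_nat_const cardsDS // cX cY.
  rewrite /S2 [leqRHS](eq_bigl (mem (Y :\: X))) => [|y].
    apply: leq_sum => y; rewrite !inE => /andP[yX /eqP yj0].
    apply: common_zeros_ge => // [a|].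
      by apply: contra yX => /eqP ->; apply: imset_f.
    rewrite card_gt0; apply/set0Pn; exists (val j0).
    by rewrite inE yj0 eqxx andbT; exact: (valP j0).
  by rewrite !inE andbC.
have := section_arith q_ge4 Q_gt0 S1E S2E.
have -> : (Q * q ^ 3 = q ^ e.+3)%N by rewrite -expnD addn3.
have -> : (Q * q ^ 2 = q ^ e.+2)%N by rewrite -expnD addn2.
move=> /(_ eS); rewrite leqNgt; case/negP.
by rewrite -(exp1n e) ltn_exp2r //; lia.
Qed.

Lemma excess_eq : t = (Q * q)%N.
Proof.
have [e0|e0] := posnP e; last first.
  (* Both t and Q * q are multiples of q, and they differ by less than q. *)
  have /dvdnP[k tk] := card_dvd_excess e0; have h1 := t_le; have h2 := excess_lower_bound.
  have q0 : (0 < q)%N by lia.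
  have h3 : (k * q < Q.+1 * q)%N by rewrite mulSnr -tk; lia.
  have h4 : (Q * q < k.+1 * q)%N by rewrite mulSnr -tk; lia.
  rewrite !ltn_pmul2r // in h3 h4.
  by rewrite tk; congr (_ * _)%N; lia.
(* Remaining case r = 3, where Q = 1: divisibility of the level sizes by q - 1 makes the standard
   equations decisive. *)
have [_ E1 E2] := level_counts.
have /dvdnP[b1 e1] := level_dvd g m; have /dvdnP[b2 e2] := level_dvd g M.
move: E1 E2; rewrite e1 e2 cardJ e0 expn0 !mul1n => E1 E2.
have t2 : (2 < t)%N by move: t_gt; rewrite e0 expn0.
have [h1 h2] : (b1 * (q + 2) = (q ^ 2 + q + t) * q ^ 2 /\
    b2 * (q + t) = (q ^ 2 + q + t) * (q + 1))%N.
  by apply: (@solid_counts _ _ q.-1 (t - 2)%N) => //; lia.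
apply: (solid_arith q_ge4 _ t2 _ erefl h1 h2).
  exact: finField_card_odd_or_div4.
by move: t_le; rewrite e0 expn0 mul1n; lia.
Qed.

End Excess.

(** * Arithmetic once t = Q * q *)

Lemma plane_counts q Q v n B0 B1 B2 :
  q = v + 2 -> 0 < v -> 0 < Q -> n = Q * q ^ 2 + Q * q + Q * q ->
  B0 + B1 + B2 + 1 = Q * q ^ 4 ->
  B1 * (Q * q + 2 * Q) + B2 * (Q * q + Q * q) + n = n * (Q * q ^ 3) ->
  B1 * (Q * q + 2 * Q) ^ 2 + B2 * (Q * q + Q * q) ^ 2 + n ^ 2 + n * (Q * q ^ 2) =
    n * (Q * q ^ 3) + n ^ 2 * (Q * q ^ 2) ->
  B1 + q ^ 3 = Q * q ^ 4 /\ 2 * B0 + 2 * q ^ 2 = q ^ 3 + q.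
Proof.
move=> eq v0 Q0 en E0 E1 E2.
have e1 : B1 + q ^ 3 = Q * q ^ 4.
  (* With [v] = q - 2 this is m * (M - m), the coefficient of [B1] once [B2] is eliminated. *)
  have X0 : 0 < Q * (v + 4) * (Q * v) by rewrite !muln_gt0 Q0 v0; lia.
  apply/eqP; rewrite -(eqn_pmul2l X0); apply/eqP.
  have := congr1 (fun z => (Q * q + Q * q) * z) E1; move: E2; rewrite en eq; clear.
  by rewrite !expnS !expn0; lia.
split=> //.
have e2 : 2 * B2 + (q + 2) = (q + 2) * q ^ 2.
  have X0 : 0 < Q * q by rewrite muln_gt0 Q0; lia.
  apply/eqP; rewrite -(eqn_pmul2l X0); apply/eqP.
  have := congr1 (fun z => Q * (q + 2) * z) e1; move: E1; rewrite en; clear.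
  by rewrite !expnS !expn0; lia.
by move: E0 e1 e2; clear; rewrite !expnS !expn0; lia.
Qed.

(** Division by Q gives c1 * (q + 2) + 2 * c2 * q = (q + 2) * q. Hence q divides [c1], after halving
    the equation if 4 divides q, and c1 < q leaves 0. What remains, q + 2 = 2 * c2, makes q even. *)
Lemma line_arith q Q c1 c2 :
  0 < q -> 0 < Q -> odd q || (4 %| q) -> c1 < q ->
  c1 * (Q * q + 2 * Q) + c2 * (Q * q + Q * q) = Q * q ^ 2 + Q * q + Q * q ->
  c1 = 0 /\ q + 2 = 2 * c2.
Proof.
move=> q0 Q0 qp c1q e.
have e1 : c1 * (q + 2) + 2 * c2 * q = (q + 2) * q.
  apply/eqP; rewrite -(eqn_pmul2l Q0); apply/eqP.
  by move: e; rewrite -mulnn; clear; lia.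
have qc : q %| c1 -> c1 = 0.
  by move=> d; apply/eqP; rewrite -leqn0 leqNgt; apply/negP => /dvdn_leq /(_ d); lia.
have c0 : c1 = 0.
  apply: qc; case/orP: qp => [qo|/dvdnP[h qh]].
    have : q %| c1 * (q + 2) by rewrite -(dvdn_addl _ (dvdn_mull (2 * c2) (dvdnn q))) e1 dvdn_mull.
    by rewrite mulnDr (dvdn_addr _ (dvdn_mull _ (dvdnn q))) Gauss_dvdl // coprimen2.
  have e2 : c1 * (2 * h + 1) + c2 * q = (2 * h + 1) * q by move: e1; rewrite qh; clear; lia.
  have : q %| c1 * (2 * h + 1) by rewrite -(dvdn_addl _ (dvdn_mull c2 (dvdnn q))) e2 dvdn_mull.
  rewrite Gauss_dvdl // qh coprimeMl [coprime 4 _](_ : _ = true).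
    by rewrite andbT /coprime gcdnMDl gcdn1.
  by rewrite (_ : 4 = 2 ^ 2) // coprimeXl // coprime_sym coprimen2; lia.
split=> //; apply/eqP; rewrite -(eqn_pmul2r q0) -e1 c0; lia.
Qed.

(** * The 3-space of functionals with section size 0 or M *)

Section Vertex.
Local Open Scope ring_scope.
Variables (F : finFieldType) (J : finType) (e : nat) (g : J -> 'cV[F]_e.+4).
Local Notation q := #|F|.
Local Notation Q := (#|F| ^ e)%N.
Local Notation m := (#|F| ^ e * #|F| + 2 * #|F| ^ e)%N.
Local Notation M := (#|F| ^ e * #|F| + #|F| ^ e * #|F|)%N.
Hypothesis q_ge4 : (4 <= q)%N.
Hypothesis g_neq0 : forall j, g j != 0.
Hypothesis g_inj : forall i j, i != j -> ~ proportional (g i) (g j).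
Hypothesis cardJ : (#|J| = Q * q ^ 2 + Q * q + Q * q)%N.
Hypothesis zerosP : forall x : 'rV[F]_e.+4, x != 0 -> zeros g x \in [:: 0; m; M]%N.

Lemma two_Q_lt : (2 * Q < Q * q)%N.
Proof. by rewrite mulnC ltn_mul2l expn_gt0 !(leq_trans _ q_ge4). Qed.

Lemma axis_counts :
  (#|~: level g m| = q ^ 3)%N /\ (2 * #|level g 0| + 2 * q ^ 2 = q ^ 3 + q)%N.
Proof.
have Q0 : (0 < Q)%N by rewrite expn_gt0; lia.
have [E0 E1 E2] := level_counts q_ge4 g_neq0 g_inj two_Q_lt zerosP.
have [e1 e2] : (#|level g m| + q ^ 3 = Q * q ^ 4 /\
    2 * #|level g 0| + 2 * q ^ 2 = q ^ 3 + q)%N.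
  by apply: (@plane_counts q Q (q - 2) #|J|) E0 E1 E2 => //; lia.
split=> //; have := cardsC (level g m).
have -> : #|'rV[F]_e.+4| = (Q * q ^ 4)%N.
  by rewrite card_mx mul1n -expnD addn4.
by rewrite -e1 => /addnI.
Qed.

(** As [x] annihilates no column, the sections of the q functionals [y + b *: x] partition the
    columns. The member [b] = 0 does not have size [m], so fewer than q do, and [line_arith] leaves
    none. *)
Lemma pencil_through_empty x y :
  x \in level g 0 -> y \notin level g m -> (forall a, y != a *: x) ->
  (forall b, y + b *: x \notin level g m) /\ ~~ odd q.
Proof.
rewrite !inE => /andP[x0 /eqP zx] yD yx.
have cz : common_zeros g y x = 0%N.
  apply/eqP; rewrite -leqn0 -zx; apply: subset_leq_card; apply/subsetP => j.
  by rewrite !inE => /andP[].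
have yb0 b : y + b *: x != 0.
  by rewrite addr_eq0 -scaleNr.
have := pencil g y x; rewrite cz zx muln0 !addn0 cardJ => eS.
pose c (i : nat) := #|[set b : F | zeros g (y + b *: x) == i]|.
have mM : (m < M)%N := m_ltM two_Q_lt.
have m0 : (0 < m)%N := m_gt0 _ q_ge4.
have eS' : (c m * m + c M * M = Q * q ^ 2 + Q * q + Q * q)%N.
  rewrite -eS /c !card_as_sum !big_distrl -big_split /=; apply: eq_bigr => b _.
  have := zerosP (yb0 b); rewrite !inE => /or3P[] /eqP ->.
  - by rewrite !ltn_eqF // (ltn_trans m0).
  - by rewrite eqxx ltn_eqF // mul1n addn0.
  - by rewrite eqxx gtn_eqF // mul1n.
have qP := finField_card_odd_or_div4 q_ge4.
have cm : (c m < q)%N.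
  rewrite -[ltnRHS]cardsT; apply: proper_card; rewrite properE subsetT.
  apply/subsetPn; exists 0 => //; rewrite inE scale0r addr0.
  by have := yb0 0; rewrite scale0r addr0 => y0; move: yD; rewrite y0.
have [] := line_arith _ _ qP cm eS'; try by rewrite ?expn_gt0; lia.
move=> c0 c2; split; last by lia.
move=> b; rewrite inE yb0 /=; apply/negP => zb.
have : b \in set0 by rewrite -(cards0_eq c0) inE.
by rewrite inE.
Qed.

Lemma scale_notin_level a y : y \notin level g m -> a *: y \notin level g m.
Proof.
rewrite !inE; have [->|a0] := eqVneq a 0; first by rewrite scale0r eqxx.
by rewrite scaler_eq0 (negPf a0) zerosZ.
Qed.

Lemma add_empty_notin x y b :
  x \in level g 0 -> y \notin level g m -> y + b *: x \notin level g m.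
Proof.
move=> xl yD; have [/existsP[a /eqP ->]|] := boolP [exists a, y == a *: x].
  rewrite -scalerDl; apply: scale_notin_level; move: xl; rewrite !inE.
  case/andP=> _ /eqP ->; rewrite negb_and; apply/orP; right.
  by rewrite ltn_eqF // m_gt0.
rewrite negb_exists => /forallP h.
by have [] := pencil_through_empty xl yD h.
Qed.

Lemma exists_axis_plane :
  ~~ odd q /\
  exists A : 'M[F]_(3, e.+4),
    [/\ row_free A, forall y, y != 0 -> zeros g (y *m A) \in [:: 0; M]%N &
        forall j, A *m g j != 0].
Proof.
have [cD c0] := axis_counts.
have q3 : (q ^ 3 = q * q * q)%N by rewrite !expnS !expn0; lia.
have q2 : (q ^ 2 = q * q)%N by rewrite mulnn.
(* The count is q * (q - 1)^2 / 2, more than the q multiples of one functional. *)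
have big0 : (q < #|level g 0|)%N.
  have : (4 * (q * q) <= q * (q * q))%N by rewrite leq_mul2r q_ge4 orbT.
  have : (4 * q <= q * q)%N by rewrite leq_mul2r q_ge4 orbT.
  by move: c0; rewrite q3 q2; lia.
have [x xl] : exists x, x \in level g 0 by apply/card_gt0P; lia.
have x0 : x != 0 by move: xl; rewrite inE => /andP[].
have [x' x'l x'x] : exists2 x', x' \in level g 0 & x' \notin [set a *: x | a : F].
  apply/subsetPn; apply: contraL big0 => /subset_leq_card h.
  rewrite -leqNgt (leq_trans h) // (leq_trans (leq_imset_card _ _)) //.
(* The complement of [level g m] has q^3 elements, the span of [x] and [x'] at most q^2. *)
have [z zD zxx] : exists2 z, z \in ~: level g m &
    z \notin [set p.1 *: x + p.2 *: x' | p : F * F].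
  apply/subsetPn; apply/negP => /subset_leq_card; rewrite cD => h.
  have : (q * q * q <= q * q)%N.
    by rewrite -q3; apply: leq_trans h (leq_trans (leq_imset_card _ _) _); rewrite -card_prod.
  have : (4 * (q * q) <= q * (q * q))%N by rewrite leq_mul2r q_ge4 orbT.
  have : (0 < q * q)%N by rewrite muln_gt0; lia.
  lia.
rewrite inE in zD.
have x'D : x' \notin level g m.
  move: x'l; rewrite !inE => /andP[-> /eqP ->] /=.
  by rewrite ltn_eqF // m_gt0.
have x'nx a : x' != a *: x.
  by apply: contra x'x => /eqP ->; apply: imset_f.
have [_ oq] := pencil_through_empty xl x'D x'nx; split=> //.
pose A : 'M[F]_(3, e.+4) := col_mx x (col_mx x' z).
have AE (y : 'rV[F]_3) : exists a b c : F,
    y *m A = c *: z + b *: x' + a *: x /\ ([&& a == 0, b == 0 & c == 0] -> y = 0).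
  pose y' : 'rV[F]_(1 + (1 + 1)) := y.
  exists (lsubmx y' 0 0), (lsubmx (rsubmx y') 0 0), (rsubmx (rsubmx y') 0 0).
  have -> : y *m A = y' *m A by [].
  split.
    rewrite -{1}[y']hsubmxK -[X in row_mx _ X]hsubmxK /A !mul_row_col.
    rewrite [X in X *m x]mx11_scalar [X in X *m x']mx11_scalar [X in X *m z]mx11_scalar.
    by rewrite !mul_scalar_mx addrC [X in X + _]addrC.
  case/and3P => /eqP h1 /eqP h2 /eqP h3.
  have -> : y = y' by [].
  rewrite -[y']hsubmxK -[X in row_mx _ X]hsubmxK.
  rewrite [lsubmx y']mx11_scalar h1 [lsubmx _]mx11_scalar h2 [rsubmx (rsubmx y')]mx11_scalar h3.
  by rewrite raddf0 !row_mx0.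
have freeA (y : 'rV[F]_3) : y *m A = 0 -> y = 0.
  have [a [b [c [-> h]]]] := AE y => eq0; apply: h.
  have c0' : c == 0.
    apply: contraNT zxx => c0'; apply/imsetP; exists (- (c^-1 * a), - (c^-1 * b)) => //=.
    have := congr1 (fun v => c^-1 *: v) eq0.
    rewrite scaler0 !scalerDr !scalerA mulVf // scale1r -addrA => /eqP.
    by rewrite addr_eq0 opprD -!scaleNr addrC => /eqP.
  rewrite c0' andbT; move: eq0; rewrite (eqP c0') scale0r add0r => eq0.
  have b0 : b == 0.
    apply: contraT => b0; case/negP: (x'nx (- (b^-1 * a))).
    have := congr1 (fun v => b^-1 *: v) eq0.
    rewrite scaler0 !scalerDr !scalerA mulVf // scale1r => /eqP.
    by rewrite addr_eq0 -scaleNr.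
  rewrite b0 andbT; move/eqP: eq0; rewrite (eqP b0) scale0r add0r scaler_eq0.
  by rewrite (negPf x0) orbF.
exists A; split=> [|y y0|j].
- exact: inj_row_free.
- have yA0 : y *m A != 0 by apply: contra y0 => /eqP/freeA ->.
  (* Starting from a multiple of [z], adding multiples of [x'] and then of [x], both with empty
     section, never enters [level g m]. *)
  have : y *m A \notin level g m.
    have [a [b [c [-> _]]]] := AE y.
    by do 2!apply: add_empty_notin => //; apply: scale_notin_level.
  by have := zerosP yA0; rewrite !inE yA0 /=; case/or3P => -> //; rewrite orbT.
(* The first row of [A] is [x], which annihilates no column. *)
apply/negP => /eqP Aj.
have : j \in [set j | x *m g j == 0].
  have -> : x = usubmx (A : 'M_(1 + (1 + 1), _)) by rewrite col_mxKu.
  by rewrite inE mul_usub_mx [A *m _]Aj raddf0.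
have : zeros g x = 0%N by move: xl; rewrite inE => /andP[_ /eqP].
by move=> /cards0_eq ->; rewrite inE.
Qed.

End Vertex.

(** * Counting images, and spans of points *)

Lemma card_imfset_uniform (J : finType) (T : choiceType) (f : J -> T) c :
  (forall j, #|[set i | f i == f j]| = c) ->
  #|J| = #|` [fset f j | j in J]%fset| * c.
Proof.
move=> fc; set H := [fset f j | j in J]%fset.
have fH j : f j \in H by apply/imfsetP; exists j.
rewrite -sum1_card (partition_big (fun j => [` fH j]%fset) predT) //=.
rewrite cardfE -sum_nat_const; apply: eq_bigr => -[y yH] _.
have /imfsetP[j _ yj] := yH.
by rewrite -(fc j) sum1dep_card; apply: eq_card => i; rewrite !inE -val_eqE /= yj.
Qed.

Section Lines.
Local Open Scope ring_scope.
Variables (F : finFieldType) (V : vectType F).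

Lemma vlineZ (a : F) (v : V) : a != 0 -> <[a *: v]>%VS = <[v]>%VS.
Proof.
move=> a0; apply/eqP; rewrite eqEsubv -!memvE memvZ ?memv_line //=.
by apply/vlineP; exists a^-1; rewrite scalerA mulVf // scale1r.
Qed.

Lemma point_vline (X : {vspace V}) : is_point X -> exists2 v, v != 0 & X = <[v]>%VS.
Proof.
move=> /eqP dX; have X0 : X != 0%VS by rewrite -dimv_eq0 dX.
exists (vpick X); first by rewrite vpick0.
apply/esym/eqP; rewrite eqEdim -memvE memv_pick dim_vline vpick0 X0 dX.
by [].
Qed.

Lemma points_span (P Q L : {vspace V}) :
  is_point P -> is_point Q -> P != Q -> \dim L = 2%N -> (P <= L)%VS -> (Q <= L)%VS ->
  (P + Q)%VS = L.
Proof.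
move=> /eqP dP /eqP dQ PQ dL PL QL.
have PQ0 : (P :&: Q = 0)%VS.
  apply/eqP; rewrite -dimv_eq0; apply: contraNT PQ => d0.
  have e1 : (P :&: Q)%VS == P.
    by rewrite eqEdim capvSl dP lt0n.
  have e2 : (P :&: Q)%VS == Q.
    by rewrite eqEdim capvSr dQ lt0n.
  by rewrite -(eqP e1) {1}(eqP e2) eqxx.
by apply/eqP; rewrite eqEdim subv_add PL QL dimv_disjoint_sum // dP dQ dL.
Qed.

End Lines.

(** * Projection from the vertex and the hyperoval *)

Section Cone.
Local Open Scope ring_scope.
Variables (F : finFieldType) (J : finType) (e : nat) (g : J -> 'cV[F]_e.+4).
Variable A : 'M[F]_(3, e.+4).
Local Notation q := #|F|.
Local Notation Q := (#|F| ^ e)%N.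
Local Notation M := (#|F| ^ e * #|F| + #|F| ^ e * #|F|)%N.
Hypothesis g_neq0 : forall j, g j != 0.
Hypothesis g_inj : forall i j, i != j -> ~ proportional (g i) (g j).
Hypothesis cardJ : (#|J| = Q * q ^ 2 + Q * q + Q * q)%N.
Hypothesis freeA : row_free A.
Hypothesis linesP : forall y : 'rV[F]_3, y != 0 -> zeros g (y *m A) \in [:: 0; M]%N.
Hypothesis Ag_neq0 : forall j, A *m g j != 0.

Let w j := A *m g j.
(** A right inverse of [A]: its image is a plane disjoint from the vertex, the kernel of [A]. *)
Let B := pinvmx A.
Let q_gt1 : (1 < q)%N := finNzRing_gt1 F.

Lemma mulAB k (u : 'M[F]_(3, k)) : A *m (B *m u) = u.
Proof. by rewrite mulmxA mulmxVp // mul1mx. Qed.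

Lemma zeros_w y : zeros w y = zeros g (y *m A).
Proof. by apply: eq_card => j; rewrite !inE mulmxA. Qed.

(** Every line through the projected point [w j] carries exactly [M] columns, since [j] itself
    excludes 0; the count at this point then determines the fibre size. *)
Lemma card_fibre j : #|fibre w j| = (Q * q)%N.
Proof.
have := sum_zeros_at Ag_neq0 j; rewrite -/w cardJ expn1.
rewrite (bigD1 0) /=; last by rewrite inE mul0mx.
rewrite zeros0 cardJ (eq_bigr (fun _ => M)) => [|y]; last first.
  rewrite inE => /andP[yj y0]; have := linesP y0; rewrite -zeros_w !inE.
  case/orP => /eqP // /cards0_eq /setP /(_ j); rewrite !inE.
  by rewrite yj.
rewrite sum_nat_const.
have -> : #|[pred y : 'rV[F]_3 | (y \in [pred y | y *m w j == 0]) && (y != 0)]| =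
    (q ^ 2 - 1)%N.
  rewrite -(card_left_ker1 (Ag_neq0 j)) (cardsD1 0) inE mul0mx eqxx add1n subn1 /=.
  by apply: eq_card => y; rewrite !inE andbC.
move: #|fibre w j| => f eq.
have [p qp] : exists p, q = p.+1 by exists q.-1; lia.
have e2 : (q ^ 2 - 1 = p * p + 2 * p)%N by rewrite qp -mulnn; lia.
have : (q * p * f = q * p * (Q * q))%N.
  by move: (q ^ e)%N eq; rewrite e2 qp -!mulnn; clear; lia.
move/eqP; rewrite eqn_pmul2l ?muln_gt0; last by lia.
by move/eqP.
Qed.

Lemma card_vertex : #|[set v : 'cV[F]_e.+4 | A *m v == 0]| = (Q * q)%N.
Proof.
have <- : (q ^ (e.+4 - \rank A^T) = Q * q)%N.
  by rewrite mxrank_tr (eqP freeA) subSS !subSS subn0 expnSr.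
rewrite -card_left_ker -(card_imset _ (@trmx_inj _ _ _)); apply: eq_card => x.
apply/imsetP/idP => [[v]|]; rewrite !inE.
  by move=> /eqP h ->; rewrite -trmx_mul h trmx0.
move=> /eqP h; exists x^T; last by rewrite trmxK.
by rewrite inE -trmx_eq0 trmx_mul trmxK h.
Qed.

(* The fibre over w j has as many points as the vertex has vectors. *)
Lemma cone_full j v : A *m v = 0 -> exists i, exists2 a, a != 0 & g j + v = a *: g i.
Proof.
move=> Av.
pose c i := odflt 0 [pick a | w i == a *: w j].
have cP i : i \in fibre w j -> w i = c i *: w j /\ c i != 0.
  rewrite inE => /existsP[a wa]; rewrite /c; case: pickP => [b /eqP wb|/(_ a)].
    by split=> //=; apply: contra (Ag_neq0 i) => /eqP b0; rewrite -/(w i) wb b0 scale0r.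
  by rewrite wa.
(* Rescaling [g i] to have the same image as [g j] and subtracting maps the fibre into the kernel,
   injectively because no two columns are proportional. *)
pose f i := (c i)^-1 *: g i - g j.
have f_inj : {in fibre w j &, injective f}.
  move=> i1 i2 /cP[_ c1] /cP[_ c2] /addIr e12; apply/eqP; apply: contraT => /g_inj; case.
  exists (c i1 * (c i2)^-1); rewrite -scalerA -e12 scalerA mulfV // scale1r.
  by [].
have : f @: fibre w j = [set v | A *m v == 0].
  apply/eqP; rewrite eqEcard card_in_imset // card_fibre card_vertex leqnn andbT.
  apply/subsetP => _ /imsetP[i /cP[wi ci] ->].
  by rewrite inE mulmxBr -scalemxAr -/(w i) wi scalerA mulVf // scale1r subrr.
move/setP/(_ v); rewrite [RHS]inE Av eqxx => /imsetP[i /cP[_ ci] ->].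
by exists i, (c i)^-1; rewrite ?invr_eq0 // addrC subrK.
Qed.

(** The point where the span of the vertex and [g j] meets the image of [B]. *)
Let line_of j := <[B *m w j]>%VS.

Lemma line_of_eq i j : (line_of i == line_of j) = (i \in fibre w j).
Proof.
rewrite inE; apply/eqP/existsP => [eij|[a /eqP wa]].
  have : B *m w i \in line_of j by rewrite -eij memv_line.
  by case/vlineP => a /(congr1 (mulmx A)); rewrite -scalemxAr !mulAB => ->; exists a.
have a0 : a != 0 by apply: contra (Ag_neq0 i) => /eqP a0; rewrite -/(w i) wa a0 scale0r.
by rewrite /line_of wa -scalemxAr vlineZ.
Qed.

Lemma Bw_neq0 j : B *m w j != 0.
Proof. by apply: contra (Ag_neq0 j) => /eqP/(congr1 (mulmx A)); rewrite mulAB mulmx0 => /eqP. Qed.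

Lemma line_of_point j : is_point (line_of j).
Proof. by rewrite /is_point dim_vline Bw_neq0. Qed.

(** A line through three distinct points would carry three disjoint fibres of Q * q columns, but it
    carries at most M = 2 * Q * q. *)
Lemma line_of_not_collinear i j k :
  line_of i != line_of j -> line_of i != line_of k -> line_of j != line_of k ->
  ~ collinear (line_of i) (line_of j) (line_of k).
Proof.
move=> ij ik jk [L [dL iL jL kL]].
have eL := points_span (line_of_point i) (line_of_point j) ij dL iL jL.
(* An equation of the line: two independent vectors of the plane have q > 1 common annihilators. *)
have [y y0 /andP[yi yj]] : exists2 y : 'rV[F]_3, y != 0 & (y *m w i == 0) && (y *m w j == 0).
  have nij : ~ proportional (w i) (w j).
    by case=> a wa; case/negP: ij; rewrite line_of_eq inE; apply/existsP; exists a; rewrite wa.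
  have := card_left_ker2 (Ag_neq0 j) nij; rewrite expn1 (cardsD1 0) inE !mul0mx eqxx /=.
  set Y := _ :\ 0 => cY; have /card_gt0P[y] : (0 < #|Y|)%N by move: q_gt1; rewrite -cY; case: #|Y|.
  by rewrite !inE => /andP[? ?]; exists y.
have yk : y *m w k == 0.
  have : B *m w k \in (line_of i + line_of j)%VS by rewrite eL memvE.
  case/memv_addP => _ /vlineP[a ->] [_ /vlineP[b ->] /(congr1 (mulmx A))].
  rewrite mulmxDr -!scalemxAr !mulAB => ->.
  by rewrite mulmxDr -!scalemxAr (eqP yi) (eqP yj) !scaler0 addr0.
have sub l : y *m w l == 0 -> fibre w l \subset [set s | y *m w s == 0].
  move=> /eqP yl; apply/subsetP => s; rewrite !inE => /existsP[a /eqP ->].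
  by rewrite -scalemxAr yl scaler0.
have dis l1 l2 : line_of l1 != line_of l2 -> fibre w l1 :&: fibre w l2 = set0.
  move=> l12; apply/setP => s; rewrite in_setI in_set0; apply/negP => /andP[].
  rewrite -!line_of_eq => /eqP e1 /eqP e2.
  by rewrite -e1 e2 eqxx in l12.
have : (#|fibre w i :|: fibre w j :|: fibre w k| <= zeros w y)%N.
  by apply: subset_leq_card; rewrite !subUset !sub.
rewrite cardsU setIUl !dis // setU0 cards0 subn0 cardsU dis // cards0 subn0.
rewrite !card_fibre zeros_w.
have : (0 < Q * q)%N by rewrite muln_gt0 expn_gt0 (ltnW q_gt1).
by have := linesP y0; rewrite !inE => /orP[] /eqP ->; move: (Q * q)%N; clear; lia.
Qed.

Lemma hypercylinder_cone : hypercylinder [fset <[g j]>%VS | j in J]%fset.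
Proof.
pose fA := linfun (mulmx A) : 'Hom('cV[F]_e.+4, 'cV[F]_3).
pose fB := linfun (mulmx B) : 'Hom('cV[F]_3, 'cV[F]_e.+4).
have fAE v : fA v = A *m v by rewrite lfunE.
have fBE v : fB v = B *m v by rewrite lfunE.
have fullA : limg fA = fullv.
  apply/eqP; rewrite eqEsubv subvf; apply/subvP => u _.
  by rewrite -[u]mulAB -fAE memv_img // memvf.
have kB : lker fB = 0%VS.
  apply/eqP; rewrite -subv0; apply/subvP => u; rewrite memv_ker fBE memv0.
  by move=> /eqP/(congr1 (mulmx A)); rewrite mulAB mulmx0 => ->.
have memker v : (v \in lker fA) = (A *m v == 0) by rewrite memv_ker fAE.
exists (lker fA), (limg fB), [fset line_of j | j in J]%fset; split.
- have := limg_ker_dim fA fullv; rewrite capfv fullA.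
  by rewrite !dimvf /dim /= !muln1.
- by rewrite limg_dim_eq ?kB ?capv0 // dimvf /dim /= muln1.
- apply/eqP; rewrite -subv0; apply/subvP => v /memv_capP[/memv_imgP[u _ ->]].
  by rewrite memker fBE mulAB => /eqP ->; rewrite mulmx0 mem0v.
- split.
  + move=> P /imfsetP[j _ ->] /=; rewrite line_of_point /= -memvE.
    by rewrite -fBE memv_img // memvf.
  + have q0 : (0 < Q * q)%N by rewrite muln_gt0 expn_gt0 (ltnW q_gt1).
    (* All fibres have Q * q columns, and the total is (q + 2) * (Q * q). *)
    apply/eqP; rewrite -(eqn_pmul2r q0) -card_imfset_uniform ?cardJ.
      by apply/eqP; rewrite -mulnn; clear; lia.
    by move=> j; rewrite -(card_fibre j); apply: eq_card => i; rewrite inE line_of_eq.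
  + move=> P1 P2 P3 /imfsetP[i _ ->] /imfsetP[j _ ->] /imfsetP[k _ ->] /=.
    exact: line_of_not_collinear.
move=> X; split=> [/imfsetP[j _ ->]|[Xp Xpi [P /imfsetP[j _ ->] /= XP]]] /=.
  split.
  - by rewrite /is_point dim_vline g_neq0.
  - by rewrite -memvE memker Ag_neq0.
  exists (line_of j); first by apply/imfsetP; exists j.
  (* The difference of [g j] and [B *m w j] lies in the vertex. *)
  rewrite -memvE -[g j](subrK (B *m w j)) addrC memv_add ?memv_line //.
  by rewrite memker mulmxBr mulAB subrr.
have [v v0 Xv] := point_vline Xp; rewrite {X Xp}Xv in Xpi XP *.
rewrite -memvE memker in Xpi; rewrite -memvE in XP.
have [_ /vlineP[c ->] [p]] := memv_addP XP.
rewrite memker => /eqP Ap ev.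
have Av : A *m v = c *: w j by rewrite ev mulmxDr -scalemxAr mulAB Ap addr0.
have c0 : c != 0 by apply: contra Xpi => /eqP c0; rewrite Av c0 scale0r.
(* Up to scaling, [v] is [g j] plus a vector of the vertex, hence proportional to a column. *)
have [|i [a a0 ei]] := @cone_full j (c^-1 *: v - g j).
  by rewrite mulmxBr -scalemxAr Av scalerA mulVf // scale1r subrr.
apply/imfsetP; exists i => //=; rewrite -(vlineZ (g i) a0) -ei addrC subrK vlineZ //.
by rewrite invr_eq0.
Qed.

End Cone.

(** * From code weights to section sizes *)

Section Codes.
Local Open Scope ring_scope.
Variable F : finFieldType.

Lemma weight_zeros N k (G : 'M[F]_(k, N)) (x : 'rV[F]_k) :
  (hamming_weight (x *m G) + zeros (fun j => col j G) x = N)%N.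
Proof.
rewrite -[RHS]card_ord -(cardsC [set j | (x *m G) ord0 j != 0]).
congr (_ + _)%N; apply: eq_card => j; rewrite !inE negbK colE mulmxA -colE.
apply/eqP/eqP => [/matrixP/(_ 0 0)|h]; first by rewrite !mxE.
by apply/matrixP => i l; rewrite !ord1 mxE h mxE.
Qed.

Lemma codeword_mem N k (G : 'M[F]_(k, N)) (C : {vspace 'rV[F]_N}) (x : 'rV[F]_k) :
  generator_matrix C G -> x *m G \in C.
Proof.
move=> /span_basis <-; rewrite mulmx_sum_row; apply: memv_suml => i _.
apply: memvZ; apply: memv_span; apply/tnthP; exists i.
by rewrite tnth_mktuple.
Qed.

Lemma codeword_neq0 N k (G : 'M[F]_(k, N)) (C : {vspace 'rV[F]_N}) (x : 'rV[F]_k) :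
  generator_matrix C G -> x != 0 -> x *m G != 0.
Proof.
move=> /basis_free /freeP fG; apply: contra => /eqP xG.
have h i : x 0 i = 0.
  apply: (fG (fun i => x 0 i)); apply: etrans xG; rewrite mulmx_sum_row.
  by apply: eq_bigr => j _; rewrite -tnth_nth tnth_mktuple.
by apply/eqP/rowP => i; rewrite h mxE.
Qed.

Lemma three_weight_hypercylinder e t N (C : {vspace 'rV[F]_N}) :
  let q := #|F| in
  (4 <= q)%N -> (2 * q ^ e < t)%N -> (t <= q ^ e * q + q - 1)%N ->
  N = (q ^ e * q ^ 2 + q ^ e * q + t)%N -> \dim C = e.+4 -> projective_code C ->
  (forall v, v \in C -> v != 0 -> hamming_weight v \in
     [:: q ^ e * q ^ 2; q ^ e * q ^ 2 + t - 2 * q ^ e; N]%N) ->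
  [/\ ~~ odd q, t = (q ^ e * q)%N & hypercylinder_code e.+3 C].
Proof.
move=> q q4 t_gt t_le eN dC; rewrite /projective_code dC => -[G [genG G0 Gprop]] wtC.
pose g j := col j G.
have g_inj i j : i != j -> ~ proportional (g i) (g j) by exact: Gprop.
(* Weight and section size add up to N, so the three weights give, in order, the sizes Q * q + t, Q
   * q + 2 * Q and 0. *)
have zerosP x : x != 0 ->
    zeros g x \in [:: 0; q ^ e * q + 2 * q ^ e; q ^ e * q + t]%N.
  move=> x0; have := weight_zeros G x; rewrite -/g.
  have := wtC _ (codeword_mem x genG) (codeword_neq0 genG x0); rewrite !inE.
  move: t_gt eN; clear; move: (q ^ e * q ^ 2)%N (q ^ e * q)%N (q ^ e)%N => a b c.
  by lia.
have cJ : #|'I_N| = (q ^ e * q ^ 2 + q ^ e * q + t)%N by rewrite card_ord.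
have et : t = (q ^ e * q)%N := excess_eq q4 G0 g_inj cJ t_gt t_le zerosP.
rewrite et in cJ zerosP.
have [oq [A [freeA linesP Ag]]] := exists_axis_plane q4 G0 g_inj cJ zerosP.
split=> //; exists [fset <[g j]>%VS | j in 'I_N]%fset; split.
  exact: hypercylinder_cone G0 g_inj cJ freeA linesP Ag.
exists G; split=> // [i j /= eij|X].
  apply/eqP; apply: contraT => /Gprop; case.
  have /vlineP[a ->] : col i G \in <[col j G]>%VS by rewrite -eij memv_line.
  by exists a.
split=> [/imfsetP[j _ ->]|[j ->]]; first by exists j.
by apply/imfsetP; exists j.
Qed.

End Codes.

Theorem theorem6p1 (F : finFieldType) (q t r : nat)
  (hqF : #|F| = q) (hq : 4 <= q) (ht : 0 < t) (hr : 3 <= r)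
  (htl : 2 * q ^ (r - 3) < t) (htu : t <= q ^ (r - 2) + q - 1)
  (C : {vspace 'rV[F]_(q ^ (r - 1) + q ^ (r - 2) + t)})
  (hdim : \dim C = r.+1)
  (hproj : projective_code C)
  (hwt : forall v, v \in C -> v != 0%R ->
     hamming_weight v \in
       [:: q ^ (r - 1);
           q ^ (r - 1) + t - 2 * q ^ (r - 3);
           q ^ (r - 1) + q ^ (r - 2) + t]) :
  [/\ ~~ odd q, t = q ^ (r - 2) & hypercylinder_code r C].
Proof.
have [e re] : exists e, r = e.+3 by exists (r - 3); lia.
subst r q.
have e1 : #|F| ^ (e.+3 - 1) = #|F| ^ e * #|F| ^ 2 by rewrite -expnD subn1 addn2.
have e2 : #|F| ^ (e.+3 - 2) = #|F| ^ e * #|F| by rewrite subn2 expnSr.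
have e3 : #|F| ^ (e.+3 - 3) = #|F| ^ e by rewrite !subSS subn0.
move: C hdim hproj hwt; rewrite e2 e3 in htl htu *; rewrite e1 => C.
exact: three_weight_hypercylinder.
Qed.
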